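(* Let $\mathcal{C}$ be a category of partitions, let $N$ be an integer and let $\mathbb{G}$ be the associated easy quantum group. Let $p\in \mathrm{Proj}_{\mathcal{C}}(k)$ and $q\in \mathrm{Proj}_{\mathcal{C}}(l)$. Then the representations $u_{p}$ and $u_{q}$ are unitarily equivalent if and only if either $p\sim q$ in $\mathcal{C}$ (that is, there is $r\in\mathcal{C}(k,l)$ with $r^{*}r=p$ and $rr^{*}=q$) or $u_{p}=u_{q}=0$.
   Context: Partitions. For integers $k,l\ge 0$, $P(k,l)$ is the set of set-partitions (into blocks) of the disjoint union of $k$ upper points, labelled $1,\dots,k$ from left to right, and $l$ lower points, labelled $1',\dots,l'$. A through-block is a block containing both upper and lower points; $b(p)$ and $t(p)$ are the numbers of blocks and of through-blocks, and $\beta(p)=b(p)-t(p)$. Operations: $p\otimes q$ is horizontal concatenation; for $p\in P(k,l)$, $q\in P(l,m)$, the composition $qp\in P(k,m)$ is vertical concatenation ($p$ on top, $q$ below, the lower points of $p$ identified with the upper points of $q$, then the middle points removed); $p^{*}\in P(l,k)$ is $p$ turned upside down; a rotation moves the leftmost (or rightmost) point of one row to the leftmost (resp. rightmost) position of the other row, keeping the block structure. The identity partition $|\in P(1,1)$ has a single block. A partition $p\in P(k,k)$ is projective if $p=p^{*}=pp$. A category of partitions $\mathcal{C}$ is a collection of subsets $\mathcal{C}(k,l)\subseteq P(k,l)$ ($k,l\ge0$) closed under tensor product, composition (when defined), involution and rotation, with $|\in\mathcal{C}(1,1)$. $\mathrm{Proj}_{\mathcal{C}}(k)$ is the set of projective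 partitions in $\mathcal{C}(k,k)$. For projective $p,q\in P(k,k)$, $q\preceq p$ means $pq=q$ (equivalently $qp=q$), and $q\prec p$ means $q\preceq p$, $q\ne p$. Linear maps. Let $N\geq 1$ and let $e_1,\dots,e_N$ be the canonical basis of $\mathbb{C}^N$. For $p\in P(k,l)$, $\mathring{T}_p:(\mathbb{C}^N)^{\otimes k}\to(\mathbb{C}^N)^{\otimes l}$ is $\mathring{T}_p(e_{i_1}\otimes\cdots\otimes e_{i_k})=\sum_{j_1,\dots,j_l=1}^N\delta_p(i,j)\,e_{j_1}\otimes\cdots\otimes e_{j_l}$, where $\delta_p(i,j)=1$ if, after labelling the upper points by $i$ and the lower points by $j$, all points in a common block have equal labels, and $\delta_p(i,j)=0$ otherwise. Set $T_p=N^{-\beta(p)/2}\mathring{T}_p$ (for projective $p$, $T_p$ is an orthogonal projection). Easy quantum groups. The easy quantum group associated with $\mathcal{C}$ and $N$ is the unique compact matrix quantum group $\mathbb{G}$ ($S_N\subset\mathbb{G}\subset O_N^+$) with $N$-dimensional fundamental representation $u$ such that the intertwiner spaces are $\mathrm{Hom}(u^{\otimes k},u^{\otimes l})=\mathrm{Span}\{T_p: p\in\mathcal{C}(k,l)\}$ for all $k,l\ge0$. Representations $u_p$. For $p\in\mathrm{Proj}_{\mathcal{C}}(k)$ let $R_p=\bigvee_{q\in\mathrm{Proj}_{\mathcal{C}}(k),\,q\prec p}T_q$ (supremum among projections of the finite-dimensional von Neumann algebra $\mathrm{Hom}(u^{\otimes k},u^{\otimes k})$, $0$ if there is no such $q$),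 let $P_p=T_p-R_p$, and let $u_p=(\iota\otimes P_p)(u^{\otimes k})$ be the subrepresentation of $u^{\otimes k}$ on the range of $P_p$, where $\iota$ is the identity of $C(\mathbb{G})$ ($u_p$ may be zero). *)

(* Defs.v *)
From HB Require Import structures.
From mathcomp Require Import all_boot all_order all_algebra all_fingroup.

Set Implicit Arguments.
Unset Strict Implicit.
Unset Printing Implicit Defensive.

Import Order.TTheory GRing.Theory Num.Theory.

Local Open Scope ring_scope.

Definition setpart (T : finType) : Type :=
  {P : {set {set T}} | partition P [set: T]}.

HB.instance Definition _ (T : finType) := Finite.on (setpart T).
HB.instance Definition _ (T : finType) := SubType.on (setpart T).

Definition blocks (T : finType) (p : setpart T) : {set {set T}} := val p.

Definition blk (T : finType) (p : setpart T) (x : T) : {set T} :=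
  pblock (blocks p) x.

(* The partition in which x and y share a block iff F x = F y. *)
Definition part_by (T : finType) (rT : eqType) (F : T -> rT) : setpart T :=
  exist _ (preim_partition F [set: T]) (preim_partitionP F [set: T]).

(* P(k, l): inl i is the upper point i, inr j the lower point j'. *)
Definition part (k l : nat) : Type := setpart ('I_k + 'I_l)%type.

HB.instance Definition _ (k l : nat) := Finite.on (part k l).

Definition through_block (k l : nat) (B : {set 'I_k + 'I_l}) : bool :=
  [exists i : 'I_k, inl i \in B] && [exists j : 'I_l, inr j \in B].

Definition nb_blocks (k l : nat) (p : part k l) : nat := #|blocks p|.

Definition nb_through (k l : nat) (p : part k l) : nat :=
  #|[set B in blocks p | through_block B]|.

Definition nb_nonthrough (k l : nat) (p : part k l) : nat :=
  (nb_blocks p - nb_through p)%N.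

Definition pid1 : part 1 1 := part_by (fun _ : 'I_1 + 'I_1 => tt).

(* Points of p are labelled by their block in p, points of q by their block
   in q, in a disjoint union. *)
Definition ptensor (k l k' l' : nat) (p : part k l) (q : part k' l') :
    part (k + k') (l + l') :=
  part_by (fun x : 'I_(k + k') + 'I_(l + l') =>
    match x with
    | inl i => match split i with
               | inl a => inl (blk p (inl a))
               | inr b => inr (blk q (inl b))
               end
    | inr j => match split j with
               | inl a => inl (blk p (inr a))
               | inr b => inr (blk q (inr b))
               end
    end).

Definition pstar (k l : nat) (p : part k l) : part l k :=
  part_by (fun x : 'I_l + 'I_k =>
    match x with inl j => blk p (inr j) | inr i => blk p (inl i) end).

Section Composition.
Variables (k l m : nat).

(* The three rows of points in the vertical concatenation. *)
Let rows : finType := ('I_k + 'I_l + 'I_m)%type.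

Definition row12 (x : 'I_k + 'I_l) : rows := inl x.

Definition row23 (x : 'I_l + 'I_m) : rows :=
  match x with inl b => inl (inr b) | inr c => inr c end.

Definition row13 (x : 'I_k + 'I_m) : rows :=
  match x with inl a => inl (inl a) | inr c => inr c end.

Definition glue (q : part l m) (p : part k l) : rel rows := fun x y =>
  [exists a, exists b, [&& row12 a == x, row12 b == y & blk p a == blk p b]]
  || [exists a, exists b,
        [&& row23 a == x, row23 b == y & blk q a == blk q b]].

(* The composition qp, with p on top and q below: two outer points share a
   block iff they are connected through the three rows. *)
Definition pcomp (q : part l m) (p : part k l) : part k m :=
  part_by (fun x : 'I_k + 'I_m => [set z | connect (glue q p) (row13 x) z]).

End Composition.

(* Rotations move the upper point a to the position b of the lower row, or
   conversely; only the leftmost positions (a = b = ord0) and the rightmost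
   ones (a = b = ord_max) are used below. *)
Definition protd (k l : nat) (a : 'I_k.+1) (b : 'I_l.+1) (p : part k.+1 l) :
    part k l.+1 :=
  part_by (fun x : 'I_k + 'I_l.+1 =>
    match x with
    | inl i => blk p (inl (lift a i))
    | inr j => if unlift b j is Some j' then blk p (inr j')
               else blk p (inl a)
    end).

Definition protu (k l : nat) (a : 'I_k.+1) (b : 'I_l.+1) (p : part k l.+1) :
    part k.+1 l :=
  part_by (fun x : 'I_k.+1 + 'I_l =>
    match x with
    | inl i => if unlift a i is Some i' then blk p (inl i')
               else blk p (inr b)
    | inr j => blk p (inr (lift b j))
    end).

Definition projective (k : nat) (p : part k k) : bool :=
  (p == pstar p) && (p == pcomp p p).

Definition ppreceq (k : nat) (q p : part k k) : bool := pcomp p q == q.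

Definition pprec (k : nat) (q p : part k k) : bool := ppreceq q p && (q != p).

Record partition_category := PartitionCategory {
  pcat :> forall k l : nat, {set part k l};
  pcat_tensor : forall k l k' l' (p : part k l) (q : part k' l'),
    p \in pcat k l -> q \in pcat k' l' ->
    ptensor p q \in pcat (k + k') (l + l');
  pcat_comp : forall k l m (q : part l m) (p : part k l),
    q \in pcat l m -> p \in pcat k l -> pcomp q p \in pcat k m;
  pcat_star : forall k l (p : part k l),
    p \in pcat k l -> pstar p \in pcat l k;
  pcat_rot_down_left : forall k l (p : part k.+1 l),
    p \in pcat k.+1 l -> protd ord0 ord0 p \in pcat k l.+1;
  pcat_rot_down_right : forall k l (p : part k.+1 l),
    p \in pcat k.+1 l -> protd ord_max ord_max p \in pcat k l.+1;
  pcat_rot_up_left : forall k l (p : part k l.+1),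
    p \in pcat k l.+1 -> protu ord0 ord0 p \in pcat k.+1 l;
  pcat_rot_up_right : forall k l (p : part k l.+1),
    p \in pcat k l.+1 -> protu ord_max ord_max p \in pcat k.+1 l;
  pcat_id : pid1 \in pcat 1 1
}.

Definition ProjC (C : partition_category) (k : nat) : {set part k k} :=
  [set p in C k k | projective p].

Definition part_equiv (C : partition_category) (k l : nat)
    (p : part k k) (q : part l l) : Prop :=
  exists r : part k l,
    [/\ r \in C k l, pcomp (pstar r) r = p & pcomp r (pstar r) = q].

From mathcomp Require Import complex.
From mathcomp Require Import all_classical all_reals all_analysis.
Import numFieldNormedType.Exports.

Local Open Scope complex_scope.
Local Open Scope sesquilinear_scope.
Local Open Scope classical_set_scope.
Local Open Scope ring_scope.

(* The basis vectors of (C^N)^{(x)k} are indexed by maps 'I_k -> 'I_N,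
   enumerated by enum_val; operators are matrices acting on columns. *)
Definition midx (N k : nat) : finType := {ffun 'I_k -> 'I_N}.

Definition tdim (N k : nat) : nat := #|midx N k|.

Definition delta_p (N k l : nat) (p : part k l)
    (i : midx N k) (j : midx N l) : bool :=
  let label (x : 'I_k + 'I_l) : 'I_N :=
    match x with inl a => i a | inr b => j b end in
  [forall x, forall y, (blk p x == blk p y) ==> (label x == label y)].

Definition Tring (R : realType) (N k l : nat) (p : part k l) :
    'M[R[i]]_(tdim N l, tdim N k) :=
  \matrix_(j, i) (delta_p p (enum_val i) (enum_val j))%:R.

Definition Tmap (R : realType) (N k l : nat) (p : part k l) :
    'M[R[i]]_(tdim N l, tdim N k) :=
  (sqrtC (N%:R : R[i])) ^- nb_nonthrough p *: Tring R N p.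

(* The norm is a separate real-valued operation: the library's normed modules
   cannot be joined with its algebras. *)
HB.mixin Record isCStarAlgebra (R : realType) A of GRing.Algebra R[i] A := {
  cstar : A -> A;
  cnorm : A -> R;
  cstarK : involutive cstar;
  cstarD : {morph cstar : x y / x + y};
  cstarZ : forall (c : R[i]) (x : A), cstar (c *: x) = Num.conj c *: cstar x;
  cstarM : forall x y : A, cstar (x * y) = cstar y * cstar x;
  cnorm_eq0 : forall x : A, cnorm x = 0 -> x = 0;
  cnormD : forall x y : A, cnorm (x + y) <= cnorm x + cnorm y;
  cnormZ : forall (c : R[i]) (x : A), cnorm (c *: x) = Re `|c| * cnorm x;
  cnormM : forall x y : A, cnorm (x * y) <= cnorm x * cnorm y;
  cnorm_star : forall x : A, cnorm (cstar x * x) = cnorm x ^+ 2;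
  cnorm_complete : forall s : nat -> A,
    (forall e : R, 0 < e -> exists n0 : nat, forall m n : nat,
       (n0 <= m)%N -> (n0 <= n)%N -> cnorm (s m - s n) < e) ->
    exists x : A, forall e : R, 0 < e -> exists n0 : nat, forall n : nat,
       (n0 <= n)%N -> cnorm (s n - x) < e
}.

#[short(type="cstarAlgType")]
HB.structure Definition CStarAlgebra (R : realType) :=
  {A of GRing.Algebra R[i] A & isCStarAlgebra R A}.

Definition norm_dense (R : realType) (A : cstarAlgType R) (S : set A) : Prop :=
  forall (x : A) (e : R), 0 < e -> exists y, S y /\ cnorm (x - y) < e.

Definition star_hom (R : realType) (A B : cstarAlgType R)
    (f : {lrmorphism A -> B}) : Prop :=
  forall x, f (cstar x) = cstar (f x).

Definition lin_indep (R : realType) (A : cstarAlgType R) (n : nat)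
    (a : 'I_n -> A) : Prop :=
  forall c : 'I_n -> R[i], \sum_i c i *: a i = 0 -> forall i, c i = 0.

(* The C*-algebra T is a completion of the algebraic tensor product of A and
   B for some C*-norm, where x (x) y = f x * g y. *)
Definition cstar_tensor (R : realType) (A B T : cstarAlgType R)
    (f : {lrmorphism A -> T}) (g : {lrmorphism B -> T}) : Prop :=
  [/\ star_hom f, star_hom g,
      (forall x y, f x * g y = g y * f x),
      (forall n (a : 'I_n -> A) (b : 'I_n -> B), lin_indep a ->
         \sum_i f (a i) * g (b i) = 0 -> forall i, b i = 0)
    & norm_dense [set z : T | exists n (a : 'I_n -> A) (b : 'I_n -> B),
                           z = \sum_i f (a i) * g (b i)]].

Definition min_tensor (R : realType) (A B T : cstarAlgType R)
    (f : {lrmorphism A -> T}) (g : {lrmorphism B -> T}) : Prop :=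
  cstar_tensor f g /\
  forall (T' : cstarAlgType R)
         (f' : {lrmorphism A -> T'}) (g' : {lrmorphism B -> T'}),
    cstar_tensor f' g' ->
    forall n (a : 'I_n -> A) (b : 'I_n -> B),
      cnorm (\sum_i f (a i) * g (b i)) <= cnorm (\sum_i f' (a i) * g' (b i)).

(* The unital *-subalgebra generated by the entries of u. *)
Inductive pol (R : realType) (A : cstarAlgType R) (N : nat) (u : 'M[A]_N) :
    A -> Prop :=
  | pol_coef i j : pol u (u i j)
  | pol_one : pol u 1
  | pol_add x y : pol u x -> pol u y -> pol u (x + y)
  | pol_scale (c : R[i]) x : pol u x -> pol u (c *: x)
  | pol_mul x y : pol u x -> pol u y -> pol u (x * y)
  | pol_star x : pol u x -> pol u (cstar x).

Definition mx_invertible (A : pzRingType) (n : nat) (M : 'M[A]_n) : Prop :=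
  exists M' : 'M[A]_n, M *m M' = 1%:M /\ M' *m M = 1%:M.

Record cmqg (R : realType) (N : nat) := CMQG {
  CG : cstarAlgType R;
  fund : 'M[CG]_N;
  cmqg_dense : norm_dense [set x | pol fund x];
  cmqg_inv : mx_invertible fund;
  cmqg_inv_tr : mx_invertible fund^T;
  cmqg_comul : exists (T : cstarAlgType R) (f g D : {lrmorphism CG -> T}),
    [/\ min_tensor f g, star_hom D
      & forall i j, D (fund i j) = \sum_k f (fund i k) * g (fund k j)]
}.

Definition sub_ONplus (R : realType) (N : nat) (G : cmqg R N) : Prop :=
  [/\ (forall i j, cstar (fund G i j) = fund G i j),
      fund G *m (fund G)^T = 1%:M & (fund G)^T *m fund G = 1%:M].

(* For each permutation s, the evaluation u_ij |-> (i == s j) is a character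
   of the *-algebra generated by u; jointly they give the *-homomorphism from
   Pol(G) onto C(S_N). It need not extend to a reduced completion CG. *)
Definition contains_SN (R : realType) (N : nat) (G : cmqg R N) : Prop :=
  forall s : 'S_N, exists chi : CG G -> R[i],
    [/\ (forall i j, chi (fund G i j) = (i == s j)%:R), chi 1 = 1,
        (forall x y, pol (fund G) x -> pol (fund G) y ->
           chi (x + y) = chi x + chi y /\ chi (x * y) = chi x * chi y),
        (forall c x, pol (fund G) x -> chi (c *: x) = c * chi x)
      & (forall x, pol (fund G) x -> chi (cstar x) = Num.conj (chi x))].

(* iota (x) M *)
Definition cmx (R : realType) (A : cstarAlgType R) (m n : nat)
    (M : 'M[R[i]]_(m, n)) : 'M[A]_(m, n) := map_mx (fun c => c%:A) M.

Definition intertwiner (R : realType) (A : cstarAlgType R) (m n : nat)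
    (v : 'M[A]_n) (w : 'M[A]_m) (M : 'M[R[i]]_(m, n)) : Prop :=
  cmx A M *m v = w *m cmx A M.

Definition utens (R : realType) (N : nat) (G : cmqg R N) (k : nat) :
    'M[CG G]_(tdim N k) :=
  \matrix_(i, j)
     \prod_(a < k) fund G ((enum_val i : midx N k) a) ((enum_val j : midx N k) a).

Definition easy_quantum_group (R : realType) (C : partition_category)
    (N : nat) (G : cmqg R N) : Prop :=
  [/\ contains_SN G, sub_ONplus G
    & forall (k l : nat) (M : 'M[R[i]]_(tdim N l, tdim N k)),
        intertwiner (utens G k) (utens G l) M <->
        exists c : part k l -> R[i], M = \sum_(p in C k l) c p *: Tmap R N p].

Definition projection_mx (R : realType) (n : nat) (E : 'M[R[i]]_n) : Prop :=
  E^t* = E /\ E *m E = E.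

Definition proj_le (R : realType) (n : nat) (E F : 'M[R[i]]_n) : Prop :=
  F *m E = E.

Definition is_proj_sup (R : realType) (n : nat)
    (alg S : set 'M[R[i]]_n) (E : 'M[R[i]]_n) : Prop :=
  [/\ alg E, projection_mx E, (forall F, S F -> proj_le F E)
    & forall E', alg E' -> projection_mx E' ->
        (forall F, S F -> proj_le F E') -> proj_le E E'].

Definition proj_sup (R : realType) (n : nat) (alg S : set 'M[R[i]]_n) :
    'M[R[i]]_n := xget 0 [set E | is_proj_sup alg S E].

Definition Rproj (R : realType) (C : partition_category) (N : nat)
    (G : cmqg R N) (k : nat) (p : part k k) : 'M[R[i]]_(tdim N k) :=
  proj_sup [set M | intertwiner (utens G k) (utens G k) M]
    [set M | exists q : part k k,
               [/\ q \in ProjC C k, pprec q p & M = Tmap R N q]].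

Definition Pproj (R : realType) (C : partition_category) (N : nat)
    (G : cmqg R N) (k : nat) (p : part k k) : 'M[R[i]]_(tdim N k) :=
  Tmap R N p - Rproj C G p.

Definition urep (R : realType) (C : partition_category) (N : nat)
    (G : cmqg R N) (k : nat) (p : part k k) : 'M[CG G]_(tdim N k) :=
  cmx (CG G) (Pproj C G p) *m utens G k.

(* A linear map from the range of P to the range of Q is identified with the
   matrix V = Q V P that extends it by 0 on the orthogonal complement of the
   range of P; it is unitary iff V^* V and V V^* are the identities P and Q of
   the two ranges. Here v and w are representations on these ranges. *)
Definition unitarily_equiv (R : realType) (A : cstarAlgType R) (n m : nat)
    (P : 'M[R[i]]_n) (v : 'M[A]_n) (Q : 'M[R[i]]_m) (w : 'M[A]_m) : Prop :=
  exists V : 'M[R[i]]_(m, n),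
    [/\ Q *m V *m P = V, V^t* *m V = P, V *m V^t* = Q & intertwiner v w V].

(* Main.v *)
From mathcomp Require Import all_boot all_order all_algebra all_fingroup.
Require Import Defs.

Set Implicit Arguments.
Unset Strict Implicit.
Unset Printing Implicit Defensive.

Import Order.TTheory GRing.Theory Num.Theory.

(** The maps attached to partitions multiply, up to positive scalars, like the
    partitions themselves. Indeed [delta_p p] is a relation between labellings
    of the two rows, composition of partitions is composition of these
    relations ([delta_pcomp]), and the number of labellings of the middle row
    that connect two given outer labellings is the same for all pairs that are
    connected at all: with labels in Z/N, these labellings form a coset of a
    fixed group ([card_middle]). A trace computation then identifies the scalar for a
    projective partition p, and T_p is an orthogonal projection
    ([Tmap_projection]). Since r r^* r = r, every T_r is a multiple of a partial
    isometry from the range of T_{r^*r} onto the range of T_{rr^*}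
    ([Tring_partial_isometry]).

    Let V be a unitary equivalence between u_p and u_q. As V = P_q V P_p
    intertwines the tensor powers of u, it is a combination of terms
    P_q T_r P_p with r in the category, and P_q T_r P_p is a multiple of
    P_q T_s P_p with s = q r p. If s^*s is not p then it is strictly below p,
    its projection is killed by P_p, and T_s P_p = T_s T_{s^*s} P_p = 0; likewise
    P_q T_s = 0 when ss^* is not q. Hence either some s realises p ~ q, or V
    vanishes and with it P_p = V^*V and P_q = VV^*
    ([Pproj_intertwiner_eq0]).

    Conversely let r realise p ~ q and let W be the partial isometry obtained by
    rescaling T_r. Conjugation by r carries the projective partitions strictly
    below q to those strictly below p ([pprec_conj]), so W R_p W^* is a
    projection above all T_s with s strictly below q. With the same
    fact for r^*, this gives W R_p W^* = R_q ([Rproj_transport]), whence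
    W P_p W^* = P_q and W P_p is a unitary equivalence. If instead u_p and u_q
    vanish, then so do P_p and P_q ([urep_eq0]) and the zero map is one.

    All of this presupposes that the suprema R_p exist inside the algebra of
    intertwiners. The supremum of finitely many projections is the range
    projection of their sum H; it has the form H B, and it commutes with u
    because H does ([intertwiner_range], [proj_sup_exists]). *)

(** * Partitions as relations between labellings *)

Lemma mem_blk (T : finType) (p : setpart T) (x y : T) :
  (y \in blk p x) = (blk p x == blk p y).
Proof.
have /and3P[/eqP cP tP _] := valP p.
by rewrite /blk eq_pblock // cP inE.
Qed.

Lemma blk_part_by (T : finType) (rT : eqType) (F : T -> rT) (x y : T) :
  (blk (part_by F) x == blk (part_by F) y) = (F x == F y).
Proof.
rewrite -mem_blk /blk pblock_equivalence_partition ?inE //.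
by move=> a b c _ _ _; rewrite eqxx; split=> // /eqP->.
Qed.

Lemma blocks_imset (T : finType) (p : setpart T) :
  blocks p = [set blk p x | x : T].
Proof.
have /and3P[/eqP cP tP P0] := valP p.
apply/setP=> B; apply/idP/imsetP=> [pB | [x _ ->]]; last first.
  by apply: pblock_mem; rewrite cP inE.
have [B0|[x xB]] := set_0Vmem B; last first.
  by exists x => //; rewrite /blk (def_pblock tP pB xB).
by rewrite B0 in pB; rewrite /blocks pB in P0.
Qed.

Lemma eq_setpart (T : finType) (p q : setpart T) :
  (forall x y, (blk p x == blk p y) = (blk q x == blk q y)) -> p = q.
Proof.
move=> pq; apply/val_inj; rewrite -[val p]/(blocks p) -[val q]/(blocks q).
rewrite !blocks_imset; apply: eq_imset => x.
by apply/setP=> y; rewrite !mem_blk pq.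
Qed.

Definition row_label (N k l : nat) (i : midx N k) (j : midx N l)
    (x : 'I_k + 'I_l) : 'I_N :=
  match x with inl a => i a | inr b => j b end.

Lemma delta_pP (N k l : nat) (p : part k l) (i : midx N k) (j : midx N l) :
  reflect (forall x y, blk p x = blk p y -> row_label i j x = row_label i j y)
          (delta_p p i j).
Proof.
apply: (iffP forallP) => [H x y exy | H x].
  by have /forallP/(_ y) := H x; rewrite exy eqxx => /eqP.
by apply/forallP=> y; apply/implyP=> /eqP/H/eqP.
Qed.

(** With enough labels, a partition can be recovered from the labellings that
    it allows: label each point by its own block. Identities between partitions
    thereby reduce to identities between relations. *)
Lemma eq_part_delta (k l : nat) (p q : part k l) :
  (forall N (i : midx N.+1 k) (j : midx N.+1 l),
     delta_p p i j = delta_p q i j) ->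
  p = q.
Proof.
move=> pq; apply: eq_setpart => x y.
suff H (r s : part k l) :
    (forall N (i : midx N.+1 k) (j : midx N.+1 l),
       delta_p r i j -> delta_p s i j) ->
    blk s x == blk s y -> blk r x == blk r y.
  by apply/idP/idP; apply: H => N i j; rewrite pq.
move=> rs /eqP sxy.
pose lab z : 'I_#|{set 'I_k + 'I_l}|.-1.+1 := inord (enum_rank (blk r z)).
have labE z w : lab z = lab w -> blk r z = blk r w.
  move=> /(congr1 val); rewrite /= !inordK.
  - by move=> /val_inj/enum_rank_inj.
  - by rewrite prednK // (leq_ltn_trans _ (ltn_ord (enum_rank (blk r w)))).
  - by rewrite prednK // (leq_ltn_trans _ (ltn_ord (enum_rank (blk r w)))).
have rE z : row_label [ffun a => lab (inl a)] [ffun b => lab (inr b)] z = lab z.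
  by case: z => a; rewrite /= ffunE.
apply/eqP/labE; rewrite -[LHS]rE -[RHS]rE; move: sxy.
apply: (delta_pP _ _ _ (rs _ _ _ _)); apply/delta_pP => z w zw.
by rewrite !rE /lab zw.
Qed.

Lemma delta_pstar (N k l : nat) (p : part k l) (i : midx N k) (j : midx N l) :
  delta_p (pstar p) j i = delta_p p i j.
Proof.
pose sw m n (x : 'I_m + 'I_n) : 'I_n + 'I_m :=
  match x with inl a => inr a | inr b => inl b end.
have swE x y : (blk (pstar p) x == blk (pstar p) y)
    = (blk p (sw _ _ x) == blk p (sw _ _ y)).
  by rewrite blk_part_by; case: x => ?; case: y => ?.
have lE x : row_label j i x = row_label i j (sw _ _ x) by case: x.
apply/delta_pP/delta_pP => H x y.
  move=> /eqP exy; have := H (sw _ _ x) (sw _ _ y); rewrite !lE.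
  have K z : sw _ _ (sw k l z) = z by case: z.
  by rewrite !K; apply; apply/eqP; rewrite swE !K.
by move=> /eqP; rewrite swE !lE => /eqP/H.
Qed.

Lemma glue_sym (k l m : nat) (q : part l m) (p : part k l) :
  connect_sym (glue q p).
Proof.
apply: sym_connect_sym => x y; rewrite /glue.
by congr (_ || _); apply/existsP/existsP=> -[a /existsP[b /and3P[? ? ab]]];
   exists b; apply/existsP; exists a; apply/and3P; split; rewrite // eq_sym.
Qed.

(** A labelling of the middle row compatible with both partitions is a labelling
    of the three rows that is constant on the components of the glued diagram;
    an outer labelling extends to such a labelling exactly when it is constant
    on the outer part of each component. *)
Lemma delta_pcomp (N k l m : nat) (q : part l m) (p : part k l)
    (i : midx N.+1 k) (j : midx N.+1 m) :
  delta_p (pcomp q p) i j = [exists s, delta_p p i s && delta_p q s j].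
Proof.
have blkE x y : (blk (pcomp q p) x == blk (pcomp q p) y) =
    connect (glue q p) (row13 l x) (row13 l y).
  have gsym := glue_sym q p.
  rewrite blk_part_by; apply/eqP/idP => [/setP/(_ (row13 l y))|].
    by rewrite !inE connect0.
  by move=> xy; apply/setP=> z; rewrite !inE (same_connect gsym xy).
apply/delta_pP/existsP => [H | [s /andP[/delta_pP ps /delta_pP qs]]]; last first.
  move=> x y /eqP; rewrite blkE.
  pose lab (z : 'I_k + 'I_l + 'I_m) :=
    match z with inl (inl a) => i a | inl (inr b) => s b | inr c => j c end.
  have labE z : lab (row13 l z) = row_label i j z by case: z.
  have lab12 z : lab (row12 m z) = row_label i s z by case: z.
  have lab23 z : lab (row23 k z) = row_label s j z by case: z.
  rewrite -!labE => /connectP[w]; elim: w (row13 l x) => [|z w IH] u /=.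
    by move=> _ ->.
  move=> /andP[/orP[]/existsP[a /existsP[b /and3P[/eqP<- /eqP zb /eqP ab]]] pw e].
    by rewrite -(IH z) // -zb !lab12; apply: ps.
  by rewrite -(IH z) // -zb !lab23; apply: qs.
(* A middle point inherits the label of any outer point in its component;
   the components without outer points are labelled by 0. *)
pose lab (z : 'I_k + 'I_l + 'I_m) :=
  if [pick x | connect (glue q p) (row13 l x) z] is Some x
  then row_label i j x else ord0.
pose s : midx N.+1 l := [ffun b => lab (inl (inr b))].
have gsym := glue_sym q p.
have labE x : lab (row13 l x) = row_label i j x.
  rewrite /lab; case: pickP => [y yx|/(_ x)]; last by rewrite connect0.
  by apply: H; apply/eqP; rewrite blkE.
have lab_glue z w : glue q p z w -> lab z = lab w.
  move=> /connect1 zw; rewrite /lab; congr (if _ is Some x then _ else _).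
  by apply: eq_pick => x; rewrite /= (same_connect_r gsym zw).
have lab12 z : lab (row12 m z) = row_label i s z.
  by case: z => a; [exact: (labE (inl a))|rewrite /= ffunE].
have lab23 z : lab (row23 k z) = row_label s j z.
  by case: z => a; [rewrite /= ffunE|exact: (labE (inr a))].
exists s; apply/andP; split; apply/delta_pP => x y xy.
  rewrite -!lab12; apply: lab_glue; apply/orP; left.
  by apply/existsP; exists x; apply/existsP; exists y; rewrite !eqxx xy eqxx.
rewrite -!lab23; apply: lab_glue; apply/orP; right.
by apply/existsP; exists x; apply/existsP; exists y; rewrite !eqxx xy eqxx.
Qed.

(** An upper and a lower point of a block are compared through the labellings i'
    and j that link i to j'. This difunctionality is what makes r r^* r = r. *)
Lemma delta_difunctional (N k l : nat) (p : part k l)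
    (i i' : midx N k) (j j' : midx N l) :
  delta_p p i j -> delta_p p i' j -> delta_p p i' j' -> delta_p p i j'.
Proof.
move=> /delta_pP H1 /delta_pP H2 /delta_pP H3; apply/delta_pP.
case=> a [] b ab /=.
- exact: (H1 _ _ ab).
- by rewrite [LHS](H1 _ _ ab) -[RHS](H3 _ _ ab); apply/esym/(H2 _ _ ab).
- by apply/esym; rewrite [LHS](H1 _ _ (esym ab)) -[RHS](H3 _ _ (esym ab));
    apply/esym/(H2 _ _ (esym ab)).
- exact: (H3 _ _ ab).
Qed.

(** * Algebra of partitions *)

Lemma pstarK (k l : nat) (p : part k l) : pstar (pstar p) = p.
Proof. by apply: eq_part_delta => N i j; rewrite !delta_pstar. Qed.

Lemma pcompA (k l m n : nat) (r : part m n) (q : part l m) (p : part k l) :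
  pcomp r (pcomp q p) = pcomp (pcomp r q) p.
Proof.
apply: eq_part_delta => N i j; rewrite !delta_pcomp; apply/existsP/existsP.
  move=> [s /andP[]]; rewrite delta_pcomp => /existsP[t /andP[it ts] sj].
  by exists t; rewrite it delta_pcomp; apply/existsP; exists s; rewrite ts.
move=> [t /andP[it]]; rewrite delta_pcomp => /existsP[s /andP[ts sj]].
by exists s; rewrite sj andbT delta_pcomp; apply/existsP; exists t; rewrite it.
Qed.

Lemma pstar_pcomp (k l m : nat) (q : part l m) (p : part k l) :
  pstar (pcomp q p) = pcomp (pstar p) (pstar q).
Proof.
apply: eq_part_delta => N i j; rewrite delta_pstar !delta_pcomp.
by apply: eq_existsb => s; rewrite !delta_pstar andbC.
Qed.

Lemma pcomp_pstar_pcomp (k l : nat) (r : part k l) :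
  pcomp r (pcomp (pstar r) r) = r.
Proof.
apply: eq_part_delta => N i j; rewrite delta_pcomp; apply/existsP/idP.
  move=> [s /andP[]]; rewrite delta_pcomp => /existsP[t /andP[it]].
  rewrite delta_pstar => st sj; exact: delta_difunctional it st sj.
move=> ij; exists i; rewrite ij andbT delta_pcomp; apply/existsP; exists j.
by rewrite delta_pstar ij.
Qed.

Lemma projective_star (k : nat) (p : part k k) : projective p -> pstar p = p.
Proof. by case/andP=> /eqP<-. Qed.

Lemma projective_idem (k : nat) (p : part k k) : projective p -> pcomp p p = p.
Proof. by case/andP=> _ /eqP<-. Qed.

Lemma projective_pstar_pcomp (k l : nat) (r : part k l) :
  projective (pcomp (pstar r) r).
Proof.
by rewrite /projective pstar_pcomp pstarK eqxx -pcompA pcomp_pstar_pcomp eqxx.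
Qed.

Lemma projective_pcomp_pstar (k l : nat) (r : part k l) :
  projective (pcomp r (pstar r)).
Proof. by have := projective_pstar_pcomp (pstar r); rewrite pstarK. Qed.

Lemma ProjC_pstar_pcomp (C : partition_category) (k l : nat) (r : part k l) :
  r \in C k l -> pcomp (pstar r) r \in ProjC C k.
Proof.
move=> rC; rewrite inE projective_pstar_pcomp andbT.
exact: pcat_comp (pcat_star rC) rC.
Qed.

Lemma ProjC_pcomp_pstar (C : partition_category) (k l : nat) (r : part k l) :
  r \in C k l -> pcomp r (pstar r) \in ProjC C l.
Proof.
by move=> rC; have := ProjC_pstar_pcomp (pcat_star rC); rewrite pstarK.
Qed.

Lemma preceq_compr (k : nat) (s p : part k k) :
  projective s -> projective p -> ppreceq s p -> pcomp s p = s.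
Proof.
move=> /projective_star s1 /projective_star p1 /eqP sp.
by have := congr1 (@pstar _ _) sp; rewrite pstar_pcomp s1 p1.
Qed.

(** If r^* s r were all of p = r^* r, then conjugating back by r would turn s
    into q = r r^*; this is why strictness survives. *)
Lemma pprec_conj (C : partition_category) (k l : nat) (r : part k l)
    (s : part l l) :
  r \in C k l -> s \in ProjC C l -> pprec s (pcomp r (pstar r)) ->
  let t := pcomp (pstar r) (pcomp s r) in
  t \in ProjC C k /\ pprec t (pcomp (pstar r) r).
Proof.
move=> rC; rewrite inE => /andP[sC sP] /andP[sq s_neq] t.
have qP := projective_pcomp_pstar r.
have qs : pcomp (pcomp r (pstar r)) s = s by apply/eqP.
have sq' := preceq_compr sP qP sq.
have rt : pcomp r t = pcomp s r by rewrite /t pcompA pcompA qs.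
split; last (apply/andP; split).
- rewrite inE /t (pcat_comp (pcat_star rC)) ?(pcat_comp sC rC) //=.
  apply/andP; split.
    by rewrite !pstar_pcomp pstarK (projective_star sP) pcompA.
  by rewrite -/t {2}/t -pcompA -pcompA rt (pcompA s) (projective_idem sP).
- by rewrite /ppreceq -pcompA rt.
- apply: contraNN s_neq => /eqP tp; apply/eqP.
  by rewrite -sq' pcompA -rt tp pcomp_pstar_pcomp.
Qed.

(** * Counting labellings *)

Section LabelGroup.
Variables (N k l : nat).

Lemma delta_pB (p : part k l) (i i' : midx N.+1 k) (j j' : midx N.+1 l) :
  delta_p p i j -> delta_p p i' j' -> delta_p p (i - i')%R (j - j')%R.
Proof.
move=> /delta_pP H /delta_pP H'; apply/delta_pP => x y xy.
have E z : row_label (i - i')%R (j - j')%R z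
    = (row_label i j z - row_label i' j' z)%R.
  by case: z => a; rewrite /= !ffunE.
by rewrite !E (H x y) ?(H' x y).
Qed.

Lemma delta_p0 (p : part k l) : delta_p p (0%R : midx N.+1 k) 0%R.
Proof. by apply/delta_pP => -[] a [] b _; rewrite /= !ffunE. Qed.

End LabelGroup.

(** The middle labellings between two outer labellings, if there are any, form a
    coset of the group of those between the zero labellings. *)
Lemma card_middle (N k l m : nat) (q : part l m) (p : part k l) : (0 < N)%N ->
  exists2 c, (0 < c)%N & forall (i : midx N k) (j : midx N m),
    #|[set s | delta_p p i s && delta_p q s j]|
    = (c * delta_p (pcomp q p) i j)%N.
Proof.
case: N => // N _.
exists #|[set s : midx N.+1 l | delta_p p 0%R s && delta_p q s 0%R]|.
  by apply/card_gt0P; exists 0%R; rewrite inE !delta_p0.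
move=> i j; rewrite delta_pcomp; case: existsP => [[s0 /andP[is0 s0j]]|nex].
  rewrite muln1.
  pose shift (t : midx N.+1 l) : midx N.+1 l := (s0 + t)%R.
  have shift_inj : injective shift by apply: addrI.
  rewrite -[RHS](card_imset _ shift_inj); apply: eq_card => s.
  rewrite inE; apply/idP/imsetP => [/andP[is_ sj]|[t]].
    exists (s - s0)%R; last by rewrite /shift addrC subrK.
    have := delta_pB is_ is0; have := delta_pB sj s0j.
    by rewrite inE !subrr => -> ->.
  rewrite inE => /andP[t0 t0'] ->; apply/andP.
  have := delta_pB is0 (delta_pB (delta_p0 N p) t0).
  have := delta_pB s0j (delta_pB (delta_p0 N q) t0').
  by rewrite sub0r opprK !subr0 => -> ->.
rewrite muln0; apply/eqP; rewrite cards_eq0; apply/eqP/setP => s.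
by rewrite !inE; apply/negP => sP; apply: nex; exists s.
Qed.

(** Both sides count the fibres, and the fibres of f and g are the same. *)
Lemma card_imset_kernel (T rT rT' : finType) (f : T -> rT) (g : T -> rT') :
  (forall x y, (f x == f y) = (g x == g y)) ->
  #|[set f x | x : T]| = #|[set g x | x : T]|.
Proof.
have fib (sT : finType) (h : T -> sT) :
    #|[set h x | x : T]| = #|[set [set z | h z == h x] | x : T]|.
  rewrite -(@card_in_imset _ _ (fun y => [set z | h z == y])).
    by rewrite -imset_comp.
  move=> _ _ /imsetP[x _ ->] /imsetP[y _ ->] /setP/(_ x).
  by rewrite !inE eqxx => /esym/eqP.
move=> fg; rewrite [LHS]fib [RHS]fib.
have fib_fg : (fun x => [set z | f z == f x])
    =1 (fun x => [set z | g z == g x]).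
  by move=> x; apply/setP => z; rewrite !inE fg.
by rewrite (eq_imset _ fib_fg).
Qed.

Lemma card_constant_on_fibres (N : nat) (T rT : finType) (F : T -> rT) :
  #|[set f : {ffun T -> 'I_N.+1} |
      [forall x, forall y, (F x == F y) ==> (f x == f y)]]|
  = (N.+1 ^ #|[set F x | x : T]|)%N.
Proof.
pose D := [set F x | x : T].
have := card_pffun_on (ord0 : 'I_N.+1) D predT; rewrite card_ord => <-.
pose pull (g : {ffun rT -> 'I_N.+1}) := [ffun x => g (F x)].
rewrite -(@card_in_imset _ _ pull).
  apply: eq_card => f; rewrite inE; apply/forallP/imsetP => [H|[g _ ->] x].
    have {}H x y : F x = F y -> f x = f y.
      by have /forallP/(_ y)/implyP E := H x; move=> /eqP/E/eqP.
    exists [ffun y => if [pick x | F x == y] is Some x then f x else ord0].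
      apply/pffun_onP; split=> //; apply/subsetP=> y; rewrite inE ffunE.
      by case: pickP => [x /eqP<- _|]; [rewrite imset_f|rewrite eqxx].
    apply/ffunP=> x; rewrite !ffunE; case: pickP => [y /eqP/H //|/(_ x)].
    by rewrite eqxx.
  by apply/forallP=> y; apply/implyP => /eqP e; rewrite !ffunE e.
move=> g h /pffun_onP[gD _] /pffun_onP[hD _] /ffunP gh; apply/ffunP=> y.
have [/imsetP[x _ ->]|yD] := boolP (y \in D).
  by have := gh x; rewrite !ffunE.
have out (f : {ffun rT -> 'I_N.+1}) : ord0.-support f \subset D -> f y = ord0.
  by move=> /subsetP/(_ y)/contraNN/(_ yD); rewrite inE negbK => /eqP.
by rewrite !out.
Qed.

(** Up to a scalar this is the trace of T_p^* T_p. *)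
Lemma card_delta_p (N k l : nat) (p : part k l) :
  #|[set u : midx N.+1 k * midx N.+1 l | delta_p p u.1 u.2]|
  = (N.+1 ^ nb_blocks p)%N.
Proof.
rewrite /nb_blocks blocks_imset -card_constant_on_fibres.
pose h (f : {ffun 'I_k + 'I_l -> 'I_N.+1}) : midx N.+1 k * midx N.+1 l :=
  ([ffun a => f (inl a)], [ffun b => f (inr b)]).
have h_inj : injective h.
  move=> f g [/ffunP e1 /ffunP e2]; apply/ffunP=> -[] a.
    by have := e1 a; rewrite !ffunE.
  by have := e2 a; rewrite !ffunE.
have hE f x : row_label (h f).1 (h f).2 x = f x.
  by case: x => a; rewrite /= ffunE.
rewrite -(card_imset _ h_inj); apply: eq_card => -[i j].
rewrite inE; apply/idP/imsetP => [/= /delta_pP H|[f]].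
  exists [ffun x => row_label i j x].
    rewrite inE; apply/forallP=> x; apply/forallP=> y; apply/implyP=> /eqP/H e.
    by rewrite !ffunE e.
  by congr pair; apply/ffunP=> a; rewrite !ffunE.
rewrite inE => H ->; apply/delta_pP=> x y /eqP xy; rewrite !hE.
by move/forallP/(_ x)/forallP/(_ y): H; rewrite xy => /eqP.
Qed.

(** With card_constant_on_fibres this evaluates the trace of T_p. Labels on the
    upper blocks extend to a lower row s with [delta_p p i s], and then also
    [delta_p p s i] because p is symmetric, so that pp = p links i to
    itself. *)
Lemma delta_p_diag (N k : nat) (p : part k k) (i : midx N.+1 k) :
  projective p ->
  delta_p p i i = [forall x, forall y,
    (blk p (inl x) == blk p (inl y)) ==> (i x == i y)].
Proof.
move=> pP; apply/idP/forallP => [/delta_pP H x|H].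
  by apply/forallP=> y; apply/implyP => /eqP/H/eqP.
have {}H x y : blk p (inl x) = blk p (inl y) -> i x = i y.
  by have /forallP/(_ y)/implyP E := H x; move=> /eqP/E/eqP.
pose lab (B : {set 'I_k + 'I_k}) : 'I_N.+1 :=
  if [pick a | blk p (inl a) == B] is Some a then i a else ord0.
pose s : midx N.+1 k := [ffun b => lab (blk p (inr b))].
have is_ : delta_p p i s.
  have E x : row_label i s x = lab (blk p x).
    case: x => a; rewrite /= ?ffunE // /lab.
    case: pickP => [b /eqP/H //|/(_ a)].
    by rewrite eqxx.
  by apply/delta_pP => x y e; rewrite !E e.
rewrite -(projective_idem pP) delta_pcomp; apply/existsP; exists s.
by rewrite is_ -delta_pstar projective_star.
Qed.

(** Reflection exchanges the blocks that meet the upper row with those that meet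
    the lower row; the blocks lie in the union of these two families, and the
    through-blocks form their intersection. *)
Lemma nb_upper_projective (k : nat) (p : part k k) : projective p ->
  ((#|[set blk p (inl a) | a : 'I_k]|).*2 = nb_blocks p + nb_through p)%N.
Proof.
move=> pP; set U := [set _ | _ in _]; pose L := [set blk p (inr a) | a : 'I_k].
have UL : #|U| = #|L|.
  apply: card_imset_kernel => a b; rewrite -{1 2}(projective_star pP).
  exact: blk_part_by.
have blkU B : B \in blocks p -> (B \in U) = [exists a, inl a \in B].
  rewrite blocks_imset => /imsetP[x _ ->].
  apply/imsetP/existsP => [[a _ ->]|[a]].
    by exists a; rewrite mem_blk.
  by rewrite mem_blk => /eqP ->; exists a.
have blkL B : B \in blocks p -> (B \in L) = [exists a, inr a \in B].
  rewrite blocks_imset => /imsetP[x _ ->].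
  apply/imsetP/existsP => [[a _ ->]|[a]].
    by exists a; rewrite mem_blk.
  by rewrite mem_blk => /eqP ->; exists a.
have UB : U \subset blocks p.
  by apply/subsetP=> _ /imsetP[a _ ->]; rewrite blocks_imset imset_f.
have -> : nb_blocks p = #|U :|: L|.
  rewrite /nb_blocks blocks_imset; apply: eq_card => B; rewrite inE.
  apply/imsetP/orP => [[[] a _ ->]|[]/imsetP[a _ ->]].
  - by left; apply: imset_f.
  - by right; apply: imset_f.
  - by exists (inl a).
  - by exists (inr a).
have -> : nb_through p = #|U :&: L|.
  apply: eq_card => B; rewrite !inE; have [pB|pB] := boolP (B \in blocks p).
    by rewrite blkU // blkL.
  by apply/esym/negP => /andP[/(subsetP UB)]; rewrite (negPf pB).
by rewrite cardsUI -UL addnn.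
Qed.

(** Let u be the number of blocks that meet the upper row. If the square of the
    matrix with entries [delta_p p] is c times the matrix, comparing traces
    gives N^b(p) = c N^u, and 2u = b(p) + t(p) turns this into c^2 = N^beta(p).
    This is why N^(-beta(p)/2) makes T_p idempotent. *)
Lemma card_middle_projective (N k c : nat) (p : part k k) :
  projective p ->
  (forall i j : midx N.+1 k, #|[set s | delta_p p i s && delta_p p s j]|
     = (c * delta_p p i j)%N) ->
  (c ^ 2 = N.+1 ^ nb_nonthrough p)%N.
Proof.
move=> pP cE; set u := #|[set blk p (inl a) | a : 'I_k]|.
have cu : (c * N.+1 ^ u = N.+1 ^ nb_blocks p)%N.
  rewrite -card_delta_p -card_constant_on_fibres.
  transitivity (\sum_(i : midx N.+1 k) c * delta_p p i i)%N.
    rewrite -big_distrr /= -sum1dep_card; congr (c * _)%N.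
    rewrite big_mkcond; apply: eq_bigr => i _.
    by rewrite delta_p_diag //; case: ifP.
  rewrite -sum1dep_card.
  rewrite (eq_bigr (fun i => \sum_(s | delta_p p i s) 1)%N); last first.
    move=> i _; rewrite -cE sum1dep_card; apply: eq_card => s; rewrite !inE.
    by rewrite -[delta_p p s i]delta_pstar projective_star // andbb.
  by rewrite pair_big_dep.
have u2 := nb_upper_projective pP; rewrite -/u in u2.
have tb : (nb_through p <= nb_blocks p)%N.
  by apply: subset_leq_card; apply/subsetP=> B; rewrite inE => /andP[].
apply/eqP; rewrite -(eqn_pmul2r (expn_gt0 N.+1 u.*2)).
have -> : (c ^ 2 * N.+1 ^ u.*2 = N.+1 ^ (nb_blocks p).*2)%N.
  by rewrite -2!muln2 2!expnM -expnMn cu.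
by rewrite u2 -expnD /nb_nonthrough addnCA subnK // addnn.
Qed.

(** * Sums of squares and range projections of complex matrices *)

From mathcomp Require Import complex.
From mathcomp Require Import all_classical all_reals all_analysis.
Import Defs.

Local Open Scope complex_scope.
Local Open Scope sesquilinear_scope.
Local Open Scope ring_scope.

Lemma trmxC_mul (F : numClosedFieldType) (m n r : nat)
    (A : 'M[F]_(m, n)) (B : 'M[F]_(n, r)) : (A *m B)^t* = B^t* *m A^t*.
Proof. by rewrite trmx_mul map_mxM. Qed.

Lemma trmxC_sub (F : numClosedFieldType) (m n : nat) (A B : 'M[F]_(m, n)) :
  (A - B)^t* = A^t* - B^t*.
Proof. by rewrite linearB /= map_mxB. Qed.

Lemma trmxC_scale (F : numClosedFieldType) (m n : nat) (a : F)
    (A : 'M[F]_(m, n)) : (a *: A)^t* = Num.conj a *: A^t*.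
Proof. by rewrite linearZ /= map_mxZ. Qed.

(** The diagonal entries of the sum are sums of squared moduli. *)
Lemma sum_gram_eq0 (F : numClosedFieldType) (I : finType) (P : pred I)
    (m n : nat) (Y : I -> 'M[F]_(m, n)) :
  \sum_(i | P i) (Y i)^t* *m Y i = 0 -> forall i, P i -> Y i = 0.
Proof.
move=> Y0 i Pi; apply/matrixP=> a b; rewrite [RHS]mxE.
have gramE i' : ((Y i')^t* *m Y i') b b = \sum_a' `|Y i' a' b| ^+ 2.
  by rewrite mxE; apply: eq_bigr => a' _; rewrite !mxE normCK mulrC.
have ge0 i' : P i' -> 0 <= \sum_a' `|Y i' a' b| ^+ 2.
  by move=> _; apply: sumr_ge0 => a' _; apply: exprn_ge0.
have /eqP : \sum_(i' | P i') \sum_a' `|Y i' a' b| ^+ 2 = 0.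
  move/matrixP/(_ b b): Y0; rewrite summxE [RHS]mxE => e; rewrite -[RHS]e.
  by apply: eq_bigr => i' _; rewrite gramE.
rewrite psumr_eq0 // => /allP/(_ i); rewrite mem_index_enum Pi => /(_ isT).
rewrite psumr_eq0 => [/allP/(_ a)|a' _]; last exact: exprn_ge0.
by rewrite mem_index_enum => /(_ isT); rewrite sqrf_eq0 normr_eq0 => /eqP.
Qed.

(** For a generalised inverse G of A A, the matrix A G A is the orthogonal
    projection onto the range of A. The form A B of the projection matters: it
    puts the projection in the right ideal generated by A. *)
Lemma range_projection (F : numClosedFieldType) (n : nat) (A : 'M[F]_n) :
  A^t* = A ->
  exists B, let E := A *m B in [/\ E^t* = E, E *m E = E & E *m A = A].
Proof.
move=> Ah; pose G := pinvmx (A *m A).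
exists (G *m A); rewrite /= (mulmxA A G A); set E := A *m G *m A.
have AGA : A *m A *m G *m (A *m A) = A *m A by apply: mulmxKpV.
(* A kills the columns of E A - A, while these lie in the range of A. *)
have EA : E *m A = A.
  apply/eqP; rewrite -subr_eq0; apply/eqP.
  apply: (@sum_gram_eq0 _ 'I_1 predT _ _ (fun=> E *m A - A) _ ord0) => //.
  rewrite big_ord1.
  have -> : (E *m A - A)^t* = (G *m A *m A - 1%:M)^t* *m A.
    rewrite -[X in _ = _ *m X]Ah -trmxC_mul; congr (_ ^t*).
    by rewrite mulmxBr mulmx1 /E !mulmxA.
  rewrite -mulmxA (mulmxBr A).
  have -> : A *m (E *m A) = A *m A by rewrite -[RHS]AGA /E !mulmxA.
  by rewrite subrr mulmx0.
have EE : E *m E = E by rewrite {2}/E -mulmxA mulmxA mulmxA EA.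
have AE : A *m E^t* = A by rewrite -{1}Ah -trmxC_mul EA Ah.
split=> //.
have EEs : E *m E^t* = E by rewrite {1}/E -mulmxA AE.
by rewrite -EEs trmxC_mul trmxCK.
Qed.

(** * The linear map of a partition *)

Section Maps.
Variables (R : realType) (N : nat).
Hypothesis N_gt0 : (0 < N)%N.

Lemma Tring_mul_card (k l m c : nat) (q : part l m) (p : part k l) :
  (forall (i : midx N k) (j : midx N m),
    #|finset (fun s => delta_p p i s && delta_p q s j)|
    = (c * delta_p (pcomp q p) i j)%N) ->
  Tring R N q *m Tring R N p = c%:R *: Tring R N (pcomp q p).
Proof.
move=> cE; apply/matrixP=> j i.
rewrite !mxE -natrM -cE -sum1dep_card natr_sum.
rewrite [RHS]big_mkcond [RHS]big_enum_val /=; apply: eq_bigr => s _.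
by rewrite !mxE -natrM mulnb andbC; case: ifP.
Qed.

Lemma Tring_mul (k l m : nat) (q : part l m) (p : part k l) :
  exists2 c : R[i], 0 < c &
    Tring R N q *m Tring R N p = c *: Tring R N (pcomp q p).
Proof.
have [c c0 cE] := card_middle q p N_gt0; exists c%:R; first by rewrite ltr0n.
exact: Tring_mul_card.
Qed.

Lemma Tring_star (k l : nat) (p : part k l) :
  (Tring R N p)^t* = Tring R N (pstar p).
Proof. by apply/matrixP=> j i; rewrite !mxE rmorph_nat delta_pstar. Qed.

Lemma Tring_Tmap (k l : nat) (p : part k l) :
  Tring R N p = sqrtC (N%:R : R[i]) ^+ nb_nonthrough p *: Tmap R N p.
Proof.
by rewrite scalerA divff ?scale1r // expf_neq0 // sqrtC_eq0 pnatr_eq0 -lt0n.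
Qed.

Lemma Tmap_projection (k : nat) (p : part k k) :
  projective p -> projection_mx (Tmap R N p).
Proof.
move=> pP; rewrite /projection_mx /Tmap.
set s := sqrtC _; set b := nb_nonthrough p.
have s_gt0 : 0 < s by rewrite sqrtC_gt0 ltr0n.
have sb_gt0 : 0 < s ^+ b by rewrite exprn_gt0.
split.
  rewrite trmxC_scale Tring_star projective_star //; congr (_ *: _).
  by apply: conj_Creal; apply: ger0_real; rewrite invr_ge0 ltW.
have [c c_gt0 cE] := card_middle p p N_gt0.
rewrite -scalemxAl -scalemxAr (Tring_mul_card cE) (projective_idem pP).
suff -> : c%:R = s ^+ b by rewrite !scalerA divfK // gt_eqF.
apply/eqP; rewrite -(@eqrXn2 _ 2) ?ler0n ?ltW // exprAC sqrtCK -!natrX.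
rewrite eqr_nat; clear -N_gt0 pP cE; case: N N_gt0 cE => // n _ cE.
apply/eqP/card_middle_projective => // i j.
by rewrite cE projective_idem.
Qed.

(** E E X = E X reads a^2 X = a X. This pins the unknown positive scalars in
    products with T_p to 1, without any further count. *)
Lemma idempotent_absorb (F : fieldType) (m n : nat) (E : 'M[F]_m)
    (X : 'M[F]_(m, n)) (a : F) :
  a != 0 -> E *m E = E -> E *m X = a *: X -> E *m X = X.
Proof.
move=> a0 EE EX; have := congr1 (mulmx E) EX.
rewrite mulmxA EE -scalemxAr {1}EX => /(congr1 (fun Y => a^-1 *: Y)).
by rewrite !scalerA mulVf // !scale1r.
Qed.

Lemma Tmap_absorbl (k l : nat) (q : part l l) (r : part k l) :
  projective q -> pcomp q r = r -> Tmap R N q *m Tring R N r = Tring R N r.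
Proof.
move=> qP qr; have [_ TT] := Tmap_projection qP.
have [c c0 cE] := Tring_mul q r; rewrite qr in cE.
apply: (@idempotent_absorb _ _ _ _ _ (sqrtC N%:R ^- nb_nonthrough q * c)) => //.
  rewrite mulf_neq0 ?gt_eqF // invr_gt0 exprn_gt0 // sqrtC_gt0 ltr0n //.
by rewrite /Tmap -scalemxAl cE scalerA.
Qed.

Lemma Tmap_absorbr (k l : nat) (p : part k k) (r : part k l) :
  projective p -> pcomp r p = r -> Tring R N r *m Tmap R N p = Tring R N r.
Proof.
move=> pP rp; have [Th _] := Tmap_projection pP.
rewrite -[RHS]trmxCK -[LHS]trmxCK trmxC_mul Th Tring_star Tmap_absorbl //.
by rewrite -{1}(projective_star pP) -pstar_pcomp rp.
Qed.

Lemma Tmap_preceq (k : nat) (s p : part k k) :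
  projective s -> projective p -> ppreceq s p ->
  Tmap R N p *m Tmap R N s = Tmap R N s
  /\ Tmap R N s *m Tmap R N p = Tmap R N s.
Proof.
move=> sP pP sp; split.
  rewrite [Tmap R N s]/Tmap -scalemxAr Tmap_absorbl //; exact/eqP.
by rewrite [Tmap R N s]/Tmap -scalemxAl Tmap_absorbr // preceq_compr.
Qed.

End Maps.

(** * Intertwiners and suprema of projections *)

Section Intertwiners.
Variables (R : realType) (A : cstarAlgType R).

Lemma cmx_mul (m n r : nat) (X : 'M[R[i]]_(m, n)) (Y : 'M[R[i]]_(n, r)) :
  cmx A (X *m Y) = cmx A X *m cmx A Y.
Proof. exact: (@map_mxM _ _ (in_alg A)). Qed.

Lemma cmx0 (m n : nat) : cmx A (0 : 'M[R[i]]_(m, n)) = 0.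
Proof. exact: (@map_mx0 _ _ (in_alg A)). Qed.

Lemma cmx_sub (m n : nat) (X Y : 'M[R[i]]_(m, n)) :
  cmx A (X - Y) = cmx A X - cmx A Y.
Proof. exact: (@map_mxB _ _ (in_alg A)). Qed.

Lemma intertwiner_mul (m n r : nat) (u : 'M[A]_r) (v : 'M[A]_n) (w : 'M[A]_m)
    (X : 'M[R[i]]_(m, n)) (Y : 'M[R[i]]_(n, r)) :
  intertwiner v w X -> intertwiner u v Y -> intertwiner u w (X *m Y).
Proof.
by rewrite /intertwiner cmx_mul => Xi Yi; rewrite -mulmxA Yi mulmxA Xi mulmxA.
Qed.

Lemma intertwiner_sub (m n : nat) (v : 'M[A]_n) (w : 'M[A]_m)
    (X Y : 'M[R[i]]_(m, n)) :
  intertwiner v w X -> intertwiner v w Y -> intertwiner v w (X - Y).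
Proof. by rewrite /intertwiner cmx_sub mulmxBl mulmxBr => -> ->. Qed.

Lemma intertwiner_scale (m n : nat) (v : 'M[A]_n) (w : 'M[A]_m) (a : R[i])
    (X : 'M[R[i]]_(m, n)) :
  intertwiner v w X -> intertwiner v w (a *: X).
Proof.
move=> /matrixP Xi; apply/matrixP=> x y.
transitivity (a *: (cmx A X *m v) x y).
  rewrite !mxE scaler_sumr; apply: eq_bigr => z _.
  by rewrite !mxE -scalerA -scalerAl.
rewrite Xi !mxE scaler_sumr; apply: eq_bigr => z _.
by rewrite !mxE -!scalerAr scalerA.
Qed.

(** With E = H B = B^* H for the range projection E of H, moving u across H on
    either side gives E u = E u E = u E. *)
Lemma intertwiner_range (n : nat) (u : 'M[A]_n) (H B : 'M[R[i]]_n) :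
  H^t* = H -> intertwiner u u H -> (H *m B)^t* = H *m B ->
  H *m B *m H = H -> intertwiner u u (H *m B).
Proof.
set E := H *m B => Hh Hi Eh EH.
have EH' : E = B^t* *m H by rewrite -Eh trmxC_mul Hh.
have HE : H *m E = H by rewrite -{1}Hh -Eh -trmxC_mul EH Hh.
have EuE : cmx A E *m u = cmx A E *m u *m cmx A E.
  rewrite {1 2}EH' cmx_mul -!(mulmxA (cmx A (B^t*))) Hi.
  by rewrite -(mulmxA u) -cmx_mul HE.
rewrite /intertwiner EuE; apply/esym.
transitivity (cmx A H *m u *m cmx A B); first by rewrite Hi -mulmxA -cmx_mul.
rewrite -{1}EH cmx_mul -(mulmxA _ _ u) Hi mulmxA -(mulmxA _ _ (cmx A B)).
by rewrite -cmx_mul.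
Qed.

End Intertwiners.

(** The supremum is the range projection E = H B of the sum H. If F = 1 - E,
    then F H F = 0 is a sum of squares (T_i F)^* (T_i F), so E dominates each
    T_i; a projection E' that dominates them all satisfies E' H = H, hence
    E' E = E. *)
Lemma proj_sup_exists (R : realType) (A : cstarAlgType R) (n : nat)
    (u : 'M[A]_n) (I : finType) (D : pred I) (T : I -> 'M[R[i]]_n) :
  (forall i, D i -> intertwiner u u (T i)) ->
  (forall i, D i -> projection_mx (T i)) ->
  exists E, is_proj_sup [set M | intertwiner u u M]
    [set M | exists i, D i /\ M = T i] E.
Proof.
move=> Ti Tp; pose H := \sum_(i | D i) T i.
have Hh : H^t* = H.
  rewrite /H linear_sum rmorph_sum /=; apply: eq_bigr => i Di.
  by have [] := Tp i Di.
have Hi : intertwiner u u H.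
  rewrite /H; apply: (big_ind (intertwiner u u)) => //.
    by rewrite /intertwiner cmx0 mul0mx mulmx0.
  move=> X Y; rewrite /intertwiner.
  by rewrite /cmx (@map_mxD _ _ (in_alg A)) mulmxDl mulmxDr => <- <-.
have [B [Eh EE EH]] := range_projection Hh.
exists (H *m B); split=> //=.
- exact: intertwiner_range.
- move=> _ [i [Di ->]]; rewrite /proj_le.
  set E := H *m B in Eh EE EH *; pose F := 1%:M - E.
  have Fh : F^t* = F by rewrite trmxC_sub Eh trmx1 map_mx1.
  have FH : F *m H = 0 by rewrite mulmxBl mul1mx EH subrr.
  have TF j : D j -> T j *m F = 0.
    apply: (@sum_gram_eq0 _ _ D _ _ (fun j => T j *m F)).
    transitivity (F *m H *m F); last by rewrite FH mul0mx.
    rewrite mulmx_sumr mulmx_suml; apply: eq_bigr => j' Dj'.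
    have [Th TT] := Tp j' Dj'.
    by rewrite trmxC_mul Fh Th -mulmxA (mulmxA (T j')) TT mulmxA.
  apply/eqP; rewrite eq_sym -subr_eq0 -{1}[T i]mul1mx -mulmxBl -/F.
  have [Th _] := Tp i Di.
  by rewrite -Th -Fh -trmxC_mul TF // trmx0 map_mx0.
- move=> E' _ E'p E'T; rewrite /proj_le mulmxA.
  have -> // : E' *m H = H.
  rewrite {1}/H mulmx_sumr; apply: eq_bigr => i Di.
  by apply: E'T; exists i.
Qed.

(** * The projections P_p of an easy quantum group *)

Section EasyQuantumGroup.
Variables (R : realType) (C : partition_category) (N : nat).
Hypothesis N_gt0 : (0 < N)%N.
Variable G : cmqg R N.
Hypothesis hG : easy_quantum_group C G.

Local Notation Hom k l := (intertwiner (utens G k) (utens G l)).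

Lemma Tmap_intertwiner (k l : nat) (r : part k l) :
  r \in C k l -> Hom k l (Tmap R N r).
Proof.
move=> rC; have [_ _ H] := hG; apply/H.
exists (fun s => (s == r)%:R); rewrite (bigD1 r) //= eqxx scale1r.
rewrite big1 ?addr0 //.
by move=> s /andP[_ /negPf->]; rewrite scale0r.
Qed.

Lemma Tring_intertwiner (k l : nat) (r : part k l) :
  r \in C k l -> Hom k l (Tring R N r).
Proof.
by move=> rC; rewrite Tring_Tmap //; apply/intertwiner_scale/Tmap_intertwiner.
Qed.

Lemma Rproj_sup (k : nat) (p : part k k) :
  is_proj_sup [set M | Hom k k M]
    [set M | exists q : part k k,
               [/\ q \in ProjC C k, pprec q p & M = Tmap R N q]] (Rproj C G p).
Proof.
apply: (@xgetPex _ 0).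
have [||E EP] := @proj_sup_exists _ _ _ (utens G k) _
    (fun q => (q \in ProjC C k) && pprec q p) (fun q => Tmap R N q).
- by move=> q /andP[]; rewrite inE => /andP[qC _] _; apply: Tmap_intertwiner.
- by move=> q /andP[]; rewrite inE => /andP[_ qP] _; apply: Tmap_projection.
case: EP => Ei Ep E_ge E_le; exists E; split=> //.
  by move=> M [q [qC qp ->]]; apply: E_ge; exists q; rewrite qC.
move=> E' E'i E'p E'_ge; apply: E_le => // _ [q [/andP[qC qp] ->]].
by apply: E'_ge; exists q.
Qed.

Lemma Rproj_projection (k : nat) (p : part k k) :
  projection_mx (Rproj C G p).
Proof. by have [] := Rproj_sup p. Qed.

Lemma Rproj_ge (k : nat) (p s : part k k) :
  s \in ProjC C k -> pprec s p -> Rproj C G p *m Tmap R N s = Tmap R N s.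
Proof.
by move=> sC sp; have [_ _ H _] := Rproj_sup p; apply: H; exists s.
Qed.

(** T_p is itself an upper bound of the family whose supremum is R_p. *)
Lemma Tmap_Rproj (k : nat) (p : part k k) : p \in ProjC C k ->
  Tmap R N p *m Rproj C G p = Rproj C G p.
Proof.
rewrite inE => /andP[pC pP]; have [_ _ _ H] := Rproj_sup p; apply: H.
- exact: Tmap_intertwiner.
- exact: Tmap_projection.
move=> _ [s [sC /andP[sp _] ->]].
have [_ sP] : s \in C k k /\ projective s by move: sC; rewrite inE => /andP.
exact: (proj1 (Tmap_preceq R N_gt0 sP pP sp)).
Qed.

Lemma Rproj_Tmap (k : nat) (p : part k k) : p \in ProjC C k ->
  Rproj C G p *m Tmap R N p = Rproj C G p.
Proof.
move=> pC; have [Rh _] := Rproj_projection p.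
have [Th _] : projection_mx (Tmap R N p).
  by move: pC; rewrite inE => /andP[_ pP]; apply: Tmap_projection.
by rewrite -[LHS]trmxCK trmxC_mul Rh Th Tmap_Rproj.
Qed.

Lemma Pproj_projection (k : nat) (p : part k k) : p \in ProjC C k ->
  projection_mx (Pproj C G p).
Proof.
move=> pC; have [Rh RR] := Rproj_projection p.
have [Th TT] : projection_mx (Tmap R N p).
  by move: pC; rewrite inE => /andP[_ pP]; apply: Tmap_projection.
split; first by rewrite trmxC_sub Rh Th.
by rewrite mulmxBl !mulmxBr Tmap_Rproj // Rproj_Tmap // TT RR subrr subr0.
Qed.

Lemma Tmap_Pproj (k : nat) (p : part k k) : p \in ProjC C k ->
  Tmap R N p *m Pproj C G p = Pproj C G p.
Proof.
move=> pC; rewrite mulmxBr Tmap_Rproj //; congr (_ - _).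
by move: pC; rewrite inE => /andP[_ pP]; have [] := Tmap_projection R N_gt0 pP.
Qed.

Lemma Pproj_intertwiner (k : nat) (p : part k k) : p \in ProjC C k ->
  Hom k k (Pproj C G p).
Proof.
rewrite inE => /andP[pC pP]; apply: intertwiner_sub.
  exact: Tmap_intertwiner.
by have [] := Rproj_sup p.
Qed.

(** Here r^* r lies strictly below p, so R_p dominates its projection and P_p
    kills it; and T_r factors through that projection as r r^* r = r. *)
Lemma Tring_Pproj_eq0 (k l : nat) (p : part k k) (r : part k l) :
  p \in ProjC C k -> r \in C k l -> pcomp r p = r ->
  pcomp (pstar r) r != p -> Tring R N r *m Pproj C G p = 0.
Proof.
move=> pC rC rp ne; have pP : projective p by move: pC; rewrite inE => /andP[].
set s := pcomp _ _ in ne.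
have sP : projective s := projective_pstar_pcomp r.
have sp : ppreceq s p.
  apply/eqP; rewrite -(projective_star sP) -(projective_star pP) -pstar_pcomp.
  by rewrite /s -pcompA rp.
have [Rh _] := Rproj_projection p.
have [Ph _] := Pproj_projection pC.
have [Th _] := Tmap_projection R N_gt0 sP.
have PT : Pproj C G p *m Tmap R N s = 0.
  rewrite mulmxBl Rproj_ge ?ProjC_pstar_pcomp ?/pprec ?sp //.
  by have [-> _] := Tmap_preceq R N_gt0 sP pP sp; rewrite subrr.
have TP : Tmap R N s *m Pproj C G p = 0.
  by rewrite -Th -Ph -trmxC_mul PT trmx0 map_mx0.
rewrite -(@Tmap_absorbr R N N_gt0 _ _ s r sP (pcomp_pstar_pcomp r)).
by rewrite -mulmxA TP mulmx0.
Qed.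

Lemma Pproj_Tring_eq0 (k l : nat) (q : part l l) (r : part k l) :
  q \in ProjC C l -> r \in C k l -> pcomp q r = r ->
  pcomp r (pstar r) != q -> Pproj C G q *m Tring R N r = 0.
Proof.
move=> qC rC qr ne; have qP : projective q by move: qC; rewrite inE => /andP[].
have [Ph _] := Pproj_projection qC.
have := @Tring_Pproj_eq0 _ _ q (pstar r) qC (pcat_star rC).
rewrite pstarK -{1}(projective_star qP) -pstar_pcomp qr => /(_ erefl ne).
move/(congr1 (fun M => M^t*)).
by rewrite trmxC_mul Ph Tring_star pstarK trmx0 map_mx0.
Qed.

Lemma intertwiner_urep (k l : nat) (p : part k k) (q : part l l)
    (V : 'M[R[i]]_(tdim N l, tdim N k)) :
  p \in ProjC C k -> q \in ProjC C l ->
  Pproj C G q *m V = V -> V *m Pproj C G p = V ->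
  intertwiner (urep C G p) (urep C G q) V <-> Hom k l V.
Proof.
move=> pC qC QV VP; have := Pproj_intertwiner qC.
rewrite /intertwiner /urep => Qi.
by rewrite mulmxA -cmx_mul VP Qi -mulmxA -cmx_mul QV.
Qed.

(** A term P_q T_r P_p of V does not change, up to a scalar, when r is replaced
    by s = q r p. Unless s realises p ~ q, one of P_q T_s and T_s P_p
    vanishes. *)
Lemma Pproj_intertwiner_eq0 (k l : nat) (p : part k k) (q : part l l)
    (V : 'M[R[i]]_(tdim N l, tdim N k)) :
  p \in ProjC C k -> q \in ProjC C l -> ~ part_equiv C p q ->
  Hom k l V -> Pproj C G q *m V *m Pproj C G p = 0.
Proof.
move=> pC qC npq Vi; have [_ _ /(_ _ _ V) [/(_ Vi) [c ->] _]] := hG.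
have [pC' pP] : p \in C k k /\ projective p by move: pC; rewrite inE => /andP.
have [qC' qP] : q \in C l l /\ projective q by move: qC; rewrite inE => /andP.
rewrite mulmx_sumr mulmx_suml big1 // => r rC.
rewrite /Tmap !(=^~ scalemxAr, =^~ scalemxAl).
suff -> : Pproj C G q *m Tring R N r *m Pproj C G p = 0 by rewrite !scaler0.
pose s := pcomp q (pcomp r p).
have sC : s \in C k l by apply: pcat_comp => //; apply: pcat_comp.
have [a a0 e1] := Tring_mul R N_gt0 r p.
have [b b0 e2] := Tring_mul R N_gt0 q (pcomp r p).
have [Ph _] := Pproj_projection pC.
have [Qh _] := Pproj_projection qC.
have [Th _] := Tmap_projection R N_gt0 qP.
have QT : Pproj C G q *m Tmap R N q = Pproj C G q.
  by rewrite -Qh -Th -trmxC_mul Tmap_Pproj.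
rewrite -QT -(Tmap_Pproj pC) /Tmap -!mulmxA.
rewrite !(=^~ scalemxAr, =^~ scalemxAl) !scalerA.
rewrite (mulmxA (Tring R N r)) e1 !(=^~ scalemxAr, =^~ scalemxAl).
rewrite (mulmxA (Tring R N q)) e2 !(=^~ scalemxAr, =^~ scalemxAl) -/s.
suff -> : Pproj C G q *m (Tring R N s *m Pproj C G p) = 0 by rewrite !scaler0.
have sp : pcomp s p = s by rewrite /s -2!pcompA (projective_idem pP).
have qs : pcomp q s = s by rewrite /s pcompA (projective_idem qP).
have [es|ne] := eqVneq (pcomp (pstar s) s) p; last first.
  by rewrite (Tring_Pproj_eq0 pC sC sp ne) mulmx0.
have [es'|ne] := eqVneq (pcomp s (pstar s)) q; last first.
  by rewrite mulmxA (Pproj_Tring_eq0 qC sC qs ne) mul0mx.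
by case: npq; exists s; split; [exact: sC | exact: es | exact: es'].
Qed.

(** The character of Pol(G) given by the identity permutation is the counit: it
    sends the tensor power of u to the identity matrix, hence u_p to P_p. *)
Lemma urep_eq0 (k : nat) (p : part k k) : urep C G p = 0 -> Pproj C G p = 0.
Proof.
have [/(_ 1%g) [chi [chi_u chi1 chi_ring chiZ _]] _ _] := hG.
pose good x y := pol (fund G) x /\ chi x = y.
have chi0 : good 0 0.
  have p1 := pol_one (fund G); rewrite -(scale0r 1).
  by split; [exact: pol_scale|rewrite chiZ // mul0r].
move=> u0; apply/matrixP=> a b.
suff [_ <-] : good (urep C G p a b) (Pproj C G p a b).
  by rewrite u0 !mxE; have [] := chi0.
have utensE i j : good (utens G k i j) (i == j)%:R.
  rewrite mxE; have -> : (i == j)%:R = \prod_(c < k)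
      ((enum_val i : midx N k) c == (enum_val j : midx N k) c)%:R :> R[i].
    have [->|ij] := eqVneq i j; first by rewrite big1 // => c _; rewrite eqxx.
    have /existsP[c /negPf cP] : [exists c,
        (enum_val i : midx N k) c != (enum_val j : midx N k) c].
      rewrite -negb_forall; apply: contraNN ij => /forallP H.
      by apply/eqP/enum_val_inj/ffunP=> c; apply/eqP.
    by rewrite (bigD1 c) //= cP mul0r.
  apply: (big_ind2 good) => [|x x' y y' [px ex] [py ey]|c _].
  - by split; [exact: pol_one|].
  - have [_ e] := chi_ring _ _ px py; split; first exact: pol_mul.
    by rewrite e ex ey.
  - by split; [exact: pol_coef|rewrite chi_u perm1].
have -> : Pproj C G p a b = \sum_j Pproj C G p a j * (j == b)%:R.
  rewrite (bigD1 b) //= eqxx mulr1 big1 ?addr0 // => j /negPf->.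
  by rewrite mulr0.
rewrite mxE; apply: (big_ind2 good) => // [x x' y y' [px ex] [py ey]|j _].
  have [e _] := chi_ring _ _ px py; split; first exact: pol_add.
  by rewrite e ex ey.
have [pu eu] := utensE j b; rewrite mxE -scalerAl mul1r.
by split; [exact: pol_scale|rewrite chiZ // eu].
Qed.

(** A positive multiple W of T_r satisfies W^* W = T_{r^*r}, and W W^* is a
    multiple of T_{rr^*}. Because W W^* is idempotent, that multiple is 1. *)
Lemma Tring_partial_isometry (k l : nat) (r : part k l) :
  exists a : R[i], let W := a *: Tring R N r in
    W^t* *m W = Tmap R N (pcomp (pstar r) r)
    /\ W *m W^t* = Tmap R N (pcomp r (pstar r)).
Proof.
have pP := projective_pstar_pcomp r; have qP := projective_pcomp_pstar r.
set p := pcomp (pstar r) r in pP *; set q := pcomp r (pstar r) in qP *.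
have s_gt0 : 0 < sqrtC (N%:R : R[i]) by rewrite sqrtC_gt0 ltr0n.
have [c c_gt0 cE] := Tring_mul R N_gt0 (pstar r) r.
rewrite -/p (Tring_Tmap R N_gt0 p) scalerA in cE.
have [d d_gt0 dE] := Tring_mul R N_gt0 r (pstar r).
rewrite -/q (Tring_Tmap R N_gt0 q) scalerA in dE.
set c' := c * _ in cE; set d' := d * _ in dE.
have c'_gt0 : 0 < c' by rewrite mulr_gt0 // exprn_gt0.
have d'_gt0 : 0 < d' by rewrite mulr_gt0 // exprn_gt0.
set a := (sqrtC c')^-1; exists a => W.
have a_gt0 : 0 < a by rewrite invr_gt0 sqrtC_gt0.
have aJ : Num.conj a = a by apply/conj_Creal/ger0_real/ltW.
have Wh : W^t* = a *: Tring R N (pstar r) by rewrite trmxC_scale aJ Tring_star.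
have WW : W^t* *m W = Tmap R N p.
  rewrite Wh -scalemxAl -scalemxAr cE 2!scalerA -invfM -expr2 sqrtCK.
  by rewrite mulVf ?scale1r // gt_eqF.
split=> //; have WWd : W *m W^t* = (a * a * d') *: Tmap R N q.
  by rewrite Wh -scalemxAl -scalemxAr dE 2!scalerA.
have WWq : W *m W^t* *m Tmap R N q = (a * a * d') *: Tmap R N q.
  by rewrite WWd -scalemxAl; have [_ ->] := Tmap_projection R N_gt0 qP.
rewrite [LHS]WWd -WWq; apply: idempotent_absorb WWq.
  by rewrite gt_eqF // (mulr_gt0 (mulr_gt0 a_gt0 a_gt0)).
rewrite !mulmxA -(mulmxA W) WW; congr (_ *m _).
by rewrite -scalemxAl Tmap_absorbr // pcomp_pstar_pcomp.
Qed.

Lemma corner_absorb (m n : nat) (W : 'M[R[i]]_(m, n)) (W' : 'M[R[i]]_(n, m))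
    (E : 'M[R[i]]_n) (S : 'M[R[i]]_m) :
  S *m (W *m W') = S -> W *m W' *m S = S ->
  E *m (W' *m (S *m W)) = W' *m (S *m W) -> W *m E *m W' *m S = S.
Proof.
move=> SW WS EX; rewrite -{1}SW.
transitivity (W *m (E *m (W' *m (S *m W))) *m W').
  by rewrite !mulmxA.
by rewrite EX !mulmxA WS -mulmxA SW.
Qed.

(** W R_p W^* is a projection of the intertwiner algebra that dominates every
    T_s with s strictly below q: conjugation by W^* sends T_s to a multiple of
    T_{r^*sr}, which R_p dominates. As R_q is the supremum of the T_s, it lies
    below W R_p W^*. *)
Lemma Rproj_transport_le (k l : nat) (r : part k l) (a : R[i])
    (W : 'M[R[i]]_(tdim N l, tdim N k)) :
  let p := pcomp (pstar r) r in let q := pcomp r (pstar r) in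
  r \in C k l -> W = a *: Tring R N r ->
  W^t* *m W = Tmap R N p -> W *m W^t* = Tmap R N q ->
  W *m Rproj C G p *m W^t* *m Rproj C G q = Rproj C G q.
Proof.
move=> p q rC defW Wp Wq.
have pC : p \in ProjC C k := ProjC_pstar_pcomp rC.
have qC : q \in ProjC C l := ProjC_pcomp_pstar rC.
have [Rh RR] := Rproj_projection p.
have Wi : Hom k l W by rewrite defW; apply/intertwiner_scale/Tring_intertwiner.
have Whi : Hom l k (W^t*).
  rewrite defW trmxC_scale Tring_star.
  by apply/intertwiner_scale/Tring_intertwiner/pcat_star.
have [_ _ _ H] := Rproj_sup q; apply: H => /=.
- apply: intertwiner_mul Whi; apply: intertwiner_mul Wi _.
  by have [] := Rproj_sup p.
- split; first by rewrite !trmxC_mul trmxCK Rh mulmxA.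
  by rewrite !mulmxA -(mulmxA _ (W^t*)) Wp -!mulmxA (mulmxA (Tmap _ _ _))
     Tmap_Rproj // (mulmxA (Rproj _ _ _)) RR.
move=> _ [s [sC sq ->]]; rewrite /proj_le.
have [sC' sP] : s \in C l l /\ projective s by move: sC; rewrite inE => /andP.
have qP := projective_pcomp_pstar r.
have [qs sq'] := Tmap_preceq R N_gt0 sP qP (proj1 (andP sq)).
have [tC tp] := pprec_conj rC sC sq.
set t := pcomp _ (pcomp s r) in tC tp.
apply: corner_absorb.
- exact: etrans (congr1 (mulmx _) Wq) sq'.
- exact: etrans (congr1 (mulmx^~ _) Wq) qs.
have [b _ bE] := Tring_mul R N_gt0 s r.
have [c _ cE] := Tring_mul R N_gt0 (pstar r) (pcomp s r); rewrite -/t in cE.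
have [x ->] : exists x, W^t* *m (Tmap R N s *m W) = x *: Tring R N t.
  eexists; rewrite defW trmxC_scale Tring_star [Tmap R N s]/Tmap.
  rewrite !(=^~ scalemxAr, =^~ scalemxAl) bE -scalemxAr cE.
  rewrite !scalerA; reflexivity.
rewrite -scalemxAr (Tring_Tmap R N_gt0 t) -scalemxAr.
by rewrite (Rproj_ge tC tp).
Qed.

(** The inequality for r, and the one for r^* conjugated back by W, are opposite
    to each other. *)
Lemma Rproj_transport (k l : nat) (r : part k l) (a : R[i])
    (W : 'M[R[i]]_(tdim N l, tdim N k)) :
  let p := pcomp (pstar r) r in let q := pcomp r (pstar r) in
  r \in C k l -> W = a *: Tring R N r ->
  W^t* *m W = Tmap R N p -> W *m W^t* = Tmap R N q ->
  W *m Rproj C G p *m W^t* = Rproj C G q.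
Proof.
move=> p q rC defW Wp Wq.
have qC : q \in ProjC C l := ProjC_pcomp_pstar rC.
have [Rh _] := Rproj_projection p; have [Rh' _] := Rproj_projection q.
have Wh : W^t* = Num.conj a *: Tring R N (pstar r).
  by rewrite defW trmxC_scale Tring_star.
have := @Rproj_transport_le _ _ (pstar r) _ _ (pcat_star rC) Wh.
rewrite pstarK -/p -/q trmxCK => /(_ Wq Wp) le1.
have le2 := Rproj_transport_le rC defW Wp Wq; rewrite -/p -/q in le2.
have {}le2 := congr1 (fun M => M^t*) le2.
rewrite /= trmxC_mul (trmxC_mul (W *m _)) (trmxC_mul W) trmxCK Rh Rh' in le2.
rewrite (mulmxA W) in le2.
transitivity (W *m (W^t* *m Rproj C G q *m W *m Rproj C G p) *m W^t*).
  by rewrite le1.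
transitivity (W *m W^t* *m Rproj C G q *m (W *m Rproj C G p *m W^t*)).
  by rewrite !mulmxA.
by rewrite Wq (Tmap_Rproj qC) le2.
Qed.
End EasyQuantumGroup.

(** * Equivalence of the representations u_p *)

Theorem theorem4p18 (R : realType) (C : partition_category) (N : nat)
    (hN : (0 < N)%N) (G : cmqg R N) (hG : easy_quantum_group C G)
    (k l : nat) (p : part k k) (q : part l l)
    (hp : p \in ProjC C k) (hq : q \in ProjC C l) :
  unitarily_equiv (Pproj C G p) (urep C G p) (Pproj C G q) (urep C G q) <->
  part_equiv C p q \/ (urep C G p = 0 /\ urep C G q = 0).
Proof.
have [Ph PP] := Pproj_projection hN hG hp.
have [Qh QQ] := Pproj_projection hN hG hq.
split=> [[V [QVP VV VV' Vi]]|[[r [rC rp rq]]|[up0 uq0]]].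
- have [pq|npq] := pselect (part_equiv C p q); [by left|right].
  have VP : V *m Pproj C G p = V by rewrite -QVP -!mulmxA PP.
  have QV : Pproj C G q *m V = V by rewrite -QVP !mulmxA QQ.
  move: Vi => /(intertwiner_urep hN hG hp hq QV VP) Vi.
  have V0 : V = 0 by rewrite -QVP; apply: Pproj_intertwiner_eq0 Vi.
  by rewrite /urep -VV -VV' V0 !mulmx0 !mul0mx cmx0 cmx0 !mul0mx.
- have [a [Wp Wq]] := Tring_partial_isometry R hN r.
  have [W defW] : {W | W = a *: Tring R N r} by exists (a *: Tring R N r).
  rewrite -defW in Wp Wq.
  have WR := Rproj_transport hN hG rC defW Wp Wq.
  rewrite rp in Wp WR; rewrite rq in Wq WR.
  have WPW : W *m Pproj C G p *m W^t* = Pproj C G q.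
    rewrite /Pproj mulmxBr mulmxBl WR; congr (_ - _).
    rewrite -Wp !mulmxA Wq -mulmxA Wq.
    have qP : projective q by move: hq; rewrite inE => /andP[].
    by have [_ ->] := Tmap_projection R hN qP.
  have QW : Pproj C G q *m (W *m Pproj C G p) = W *m Pproj C G p.
    by rewrite -WPW -!mulmxA (mulmxA (W^t*)) Wp (Tmap_Pproj hN hG hp) PP.
  have WPP : W *m Pproj C G p *m Pproj C G p = W *m Pproj C G p.
    by rewrite -mulmxA PP.
  exists (W *m Pproj C G p); split.
  + by rewrite QW WPP.
  + by rewrite trmxC_mul Ph -mulmxA (mulmxA (W^t*)) Wp (Tmap_Pproj hN hG hp) PP.
  + by rewrite trmxC_mul Ph mulmxA WPP.
  + apply/(intertwiner_urep hN hG hp hq QW WPP).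
    apply: intertwiner_mul (Pproj_intertwiner hN hG hp).
    by rewrite defW; apply: intertwiner_scale (Tring_intertwiner hN hG rC).
- have P0 := urep_eq0 hG up0; have Q0 := urep_eq0 hG uq0.
  exists 0; rewrite P0 Q0; split;
    rewrite ?mulmx0 ?mul0mx ?trmx0 ?map_mx0 ?mul0mx //.
  by rewrite /intertwiner cmx0 mul0mx mulmx0.
Qed.
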